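(* Let $n\geq 0$ be an integer, let $X$ be a paracompact space with $\dim(X)\leq n$, let $Y$ be a space, and let $\varphi_k$, $0\leq k\leq n$, be set-valued mappings from $X$ to the nonempty subsets of $Y$ such that each $\varphi_k$ is lower locally constant and the sequence is aspherical, i.e. $\varphi_k(x)\stackrel{k}{\hookrightarrow}\varphi_{k+1}(x)$ for every $x\in X$ and every $k<n$. Then $\varphi_n$ has a continuous selection, i.e. there is a continuous map $f:X\to Y$ with $f(x)\in\varphi_n(x)$ for all $x\in X$.
   Context: All spaces are Hausdorff topological spaces; $\dim$ is covering dimension. A mapping $\varphi$ from $X$ to the nonempty subsets of $Y$ is lower locally constant if the set $\{x\in X:K\subset\varphi(x)\}$ is open in $X$ for every compact subset $K\subset Y$. For $k\geq 0$ and subsets $S,B\subset Y$, $S\stackrel{k}{\hookrightarrow}B$ means that every continuous map of the $k$-sphere $\mathbb{S}^k$ into $S$ can be extended to a continuous map of the $(k+1)$-ball $\mathbb{B}^{k+1}$ into $B$ (in particular $S\subset B$). *)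

(* Defs.v *)
From HB Require Import structures.
From mathcomp Require Import all_boot all_order all_algebra.
From mathcomp Require Import all_classical all_reals all_analysis.

Set Implicit Arguments.
Unset Strict Implicit.
Unset Printing Implicit Defensive.

Import Order.TTheory GRing.Theory Num.Theory.
Import numFieldNormedType.Exports.

Local Open Scope classical_set_scope.
Local Open Scope card_scope.
Local Open Scope ring_scope.

Definition open_cover (X : topologicalType) (U : set (set X)) : Prop :=
  (forall A, U A -> open A) /\ \bigcup_(A in U) A = setT.

Definition refines (X : Type) (V U : set (set X)) : Prop :=
  forall B, V B -> exists2 A, U A & B `<=` A.

Definition locally_finite (X : topologicalType) (V : set (set X)) : Prop :=
  forall x : X, exists2 N, nbhs x N & finite_set [set B | V B /\ B `&` N !=set0].

(* The Hausdorff axiom, which is often part of paracompactness, is a separate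
   hypothesis wherever this predicate is used. *)
Definition paracompact (X : topologicalType) : Prop :=
  forall U : set (set X), open_cover U ->
    exists V : set (set X), [/\ open_cover V, refines V U & locally_finite V].

(* Order <= n, with the normalization in which a pairwise disjoint family has
   order <= 0: every point lies in at most n + 1 members. *)
Definition order_le (X : Type) (V : set (set X)) (n : nat) : Prop :=
  forall x : X, [set B | V B /\ B x] #<= `I_n.+1.

(* dim X <= n in the sense of Cech and Lebesgue: the covers to be refined are
   the finite open ones. *)
Definition covering_dim_le (X : topologicalType) (n : nat) : Prop :=
  forall U : set (set X), finite_set U -> open_cover U ->
    exists V : set (set X),
      [/\ finite_set V, open_cover V, refines V U & order_le V n].

(* The norm of 'rV[R]_m in the library is the sup norm; it induces the usual
   topology, but the sphere and the ball below are the Euclidean ones. *)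
Definition sqnorm (R : realType) (m : nat) (v : 'rV[R]_m) : R :=
  \sum_(i < m) v ord0 i ^+ 2.

Definition unit_sphere (R : realType) (k : nat) : set 'rV[R]_k.+1 :=
  [set v | sqnorm v = 1].
Arguments unit_sphere : clear implicits.

Definition unit_ball (R : realType) (m : nat) : set 'rV[R]_m :=
  [set v | sqnorm v <= 1].
Arguments unit_ball : clear implicits.

(* A map defined on the sphere or on the ball is a total function on the
   ambient space, its values elsewhere being irrelevant: {within A, continuous f}
   is continuity for the subspace topology of A. *)
Definition sphere_extends (R : realType) (Y : topologicalType) (k : nat)
    (S B : set Y) : Prop :=
  forall f : 'rV[R]_k.+1 -> Y,
    {within unit_sphere R k, continuous f} -> f @` unit_sphere R k `<=` S ->
    exists g : 'rV[R]_k.+1 -> Y,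
      [/\ {within unit_ball R k.+1, continuous g},
          g @` unit_ball R k.+1 `<=` B &
          forall v, unit_sphere R k v -> g v = f v].

Definition lower_locally_constant (X Y : topologicalType)
    (phi : X -> set Y) : Prop :=
  forall K : set Y, compact K -> open [set x | K `<=` phi x].

(* Main.v *)
Require Import Defs.
From mathcomp Require Import all_boot all_order all_algebra finmap.
From mathcomp Require Import all_classical all_reals all_analysis.
From mathcomp Require Import ring.

Set Implicit Arguments.
Unset Strict Implicit.
Unset Printing Implicit Defensive.

Import Order.TTheory GRing.Theory Num.Theory.
Import numFieldNormedType.Exports.

Local Open Scope classical_set_scope.
Local Open Scope card_scope.
Local Open Scope ring_scope.

(** The selection is built over the skeletons of nerves of covers. Suppose given
    a locally finite open cover [U] of [X] and a map from the [k]-skeleton of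
    the nerve of [U] to [Y] that sends each simplex into [phi k x] whenever [x]
    lies in all members of [U] spanning the simplex ([nerve_selection]). For
    [k = 0] such a map amounts to a choice of points: if [y] is in [phi 0 x],
    lower local constancy for the compact set of the single point [y] gives a
    neighbourhood of [x] on which [y] is still in [phi 0]
    ([nerve_selection0]).

    To pass from [k] to [k.+1], fix [x] and consider the finitely many
    [k.+1]-simplices spanned by members of [U] that contain [x]. The map sends
    the boundary of each of them into [phi k x], so asphericity extends it over
    the simplex inside [phi k.+1 x] ([skeleton_extension]). The image of the
    extension is contained in a compact subset of [phi k.+1 x], so by lower
    local constancy the same extension has its values in [phi k.+1 x'] for all
    [x'] in a neighbourhood [O x] of [x]. The extensions chosen at different
    points need not agree, but they do not have to: for a sufficiently fine
    cover [V] there is a simplicial map from the nerve of [V] to the nerve of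
    [U] such that all members of [V] spanning a given simplex lie in one [O x],
    and the extension chosen at that [x] is used for this simplex
    ([nerve_projection], [nerve_selection_step]).

    After [n] steps the [n]-skeleton is mapped into the values of [phi n]. Since
    [X] has dimension at most [n], a partition of unity subordinate to the last
    cover can be chosen with at most [n.+1] nonzero functions at each point. It
    is then a map of [X] into the [n]-skeleton of the nerve, and its composite
    with the map constructed before is the selection ([selection_of_nerve]).

    Two classical results are needed on the way. In a paracompact Hausdorff
    space open covers have closed shrinkings and partitions of unity. And the
    covering dimension, which speaks of finite covers, controls locally finite
    covers as well ([dim_le_shrinking]). For the latter, the common intersection
    of [n.+2] given members is made empty by shrinking these members near that
    intersection only; in a locally finite cover only finitely many such
    reductions are visible near a given point, and Zorn's lemma performs all of
    them.

    A point of a nerve is a family of weights [w : {ptws I -> R}], and a map on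
    a skeleton is a family [p] of maps, one for each finite set of vertices,
    that agree on common faces. *)

(** * Locally finite families *)

(** Covers are indexed families rather than sets of sets, so that refinements,
    shrinkings and partitions of unity can keep the indices of the original
    cover as the vertices of its nerve. *)
Definition lf_family (X : topologicalType) (I : Type) (U : I -> set X) :=
  forall x : X, exists2 N, nbhs x N & finite_set [set i | U i `&` N !=set0].

Definition covers (X I : Type) (U : I -> set X) := forall x, exists i, U i x.

Definition open_family (X : topologicalType) (I : Type) (U : I -> set X) :=
  forall i, open (U i).

Definition closed_family (X : topologicalType) (I : Type) (U : I -> set X) :=
  forall i, closed (U i).

Section LocallyFinite.
Context {X : topologicalType} {I : choiceType}.
Implicit Types U V F : I -> set X.

Lemma lf_familyS U V : (forall i, V i `<=` U i) -> lf_family U -> lf_family V.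
Proof.
move=> VU lfU x; have [N xN finN] := lfU x; exists N => //.
apply: sub_finite_set finN => i [y [Vy Ny]]; exists y; split=> //; exact: VU.
Qed.

Lemma lf_family_closure U : lf_family U -> lf_family (fun i => closure (U i)).
Proof.
move=> lfU x; have [N xN finN] := lfU x.
exists N° => //; first exact: nbhs_interior.
apply: sub_finite_set finN => i [y [cUy Ny]].
exact: (cUy _ Ny).
Qed.

Lemma lf_family_point U x : lf_family U -> finite_set [set i | U i x].
Proof.
move=> /(_ x) [N xN finN]; apply: sub_finite_set finN => i Uix.
by exists x; split=> //; exact: nbhs_singleton.
Qed.

Definition members U x : {fset I} := fset_set [set i | U i x].

Lemma membersP U x i : lf_family U -> reflect (U i x) (i \in members U x).
Proof.
move=> lfU; rewrite in_fset_set; last exact: lf_family_point.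
by apply: (iffP idP); rewrite inE.
Qed.

Lemma lf_closed_bigcup F (D : set I) : closed_family F -> lf_family F ->
  closed (\bigcup_(i in D) F i).
Proof.
move=> cF lfF x clx; have [N xN finN] := lfF x.
pose J := D `&` [set i | F i `&` N !=set0].
have finJ : finite_set J by apply: sub_finite_set finN => i [].
have clJ : closed (\bigcup_(i in J) F i) by apply: closed_bigcup.
suff : (\bigcup_(i in J) F i) x by move=> [i [Di _] Fix]; exists i.
apply: clJ => M xM; have [y [[i Di Fiy] [My Ny]]] := clx _ (filterI xM xN).
by exists y; split=> //; exists i => //; split=> //; exists y.
Qed.

Lemma lf_closure_bigcup U (D : set I) : lf_family U ->
  closure (\bigcup_(i in D) U i) `<=` \bigcup_(i in D) closure (U i).
Proof.
move=> lfU.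
rewrite [Z in _ `<=` Z](_ : _ = closure (\bigcup_(i in D) closure (U i))).
  by apply: closureS => x [i Di Uix]; exists i => //; exact: subset_closure.
apply/closure_id/lf_closed_bigcup; last exact: lf_family_closure.
by move=> i; exact: closed_closure.
Qed.

End LocallyFinite.

(** * Paracompact Hausdorff spaces *)

Section Paracompact.
Context {X : topologicalType}.
Hypothesis paraX : paracompact X.

(** The members of an arbitrary locally finite refinement that are assigned to
    the same index are united; this does not spoil local finiteness, since a
    neighbourhood still meets the unions for finitely many indices only. *)
Lemma precise_refinement (I : choiceType) (O : I -> set X) :
  open_family O -> covers O ->
  exists V : I -> set X, [/\ open_family V, covers V, lf_family V &
    forall i, V i `<=` O i].
Proof.
move=> oO cO.
have [|W [[oW cW] rW lfW]] := paraX (U := range O).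
  split=> [_ [i _ <-]|]; first exact: oO.
  rewrite -subTset => x _; have [i Oix] := cO x.
  by exists (O i) => //; exists i.
have /choice[idx idxP] : forall B, exists o : option I,
    W B -> if o is Some i then B `<=` O i else False.
  move=> B; have [WB|nWB] := pselect (W B); last by exists None.
  by have [_ [i _ <-] BO] := rW _ WB; exists (Some i).
exists (fun i => \bigcup_(B in [set B | W B /\ idx B = Some i]) B); split.
- by move=> i; apply: bigcup_open => B [WB _]; exact: oW.
- move=> x; have : (\bigcup_(A in W) A) x by rewrite cW.
  move=> [B WB Bx]; have := idxP _ WB.
  by case E : (idx B) => [i|] // _; exists i; exists B.
- move=> x; have [N xN finN] := lfW x; exists N => //.
  have /finite_seqP[s sE] := finite_image idx finN.
  apply: (@sub_finite_set _ _ [set` pmap id s]); last exact: finite_seq.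
  move=> i [y [[B [WB E] By] Ny]] /=; rewrite mem_pmap.
  apply/mapP; exists (Some i) => //.
  have : (idx @` [set B | W B /\ B `&` N !=set0]) (Some i).
    by exists B => //; split=> //; exists y.
  by rewrite sE.
- by move=> i x [B [WB E] Bx]; have := idxP _ WB; rewrite E; apply.
Qed.

(** The passage from points to closed sets, used twice: from the Hausdorff
    property to regularity, and from regularity to normality. Local finiteness
    makes the closure of the union of the separating neighbourhoods equal to
    the union of their closures. *)
Lemma paracompact_separate (C D : set X) : closed C -> closed D ->
  (forall c, C c -> exists Q, [/\ open Q, Q c & closure Q `&` D = set0]) ->
  exists G, [/\ open G, C `<=` G & closure G `&` D = set0].
Proof.
move=> clC clD sepC.
have /choice[Q QP] : forall z : X, exists Q : set X, [/\ open Q, Q z &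
    (C z -> closure Q `&` D = set0) /\ (~ C z -> Q `<=` ~` C)].
  move=> z; have [Cz|nCz] := pselect (C z).
    by have [Q [oO Oz OD]] := sepC _ Cz; exists Q; split=> //; split.
  by exists (~` C); split=> [|//|]; [exact: closed_openC|split=> // _ x].
have [|z|V [oV cV lfV VO]] := @precise_refinement X Q.
- by move=> z; have [] := QP z.
- by exists z; have [] := QP z.
exists (\bigcup_(z in C) V z); split.
- by apply: bigcup_open => z _; exact: oV.
- move=> c Cc; have [z Vzc] := cV c; exists z => //.
  apply: contrapT => nCz; have [_ _ [_ /(_ nCz)]] := QP z.
  by apply; [exact: VO Vzc|].
- rewrite -subset0 => x [/lf_closure_bigcup -/(_ lfV) [z Cz clx] Dx].
  by have [_ _ [/(_ Cz) <-]] := QP z; split=> //; exact: closureS clx.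
Qed.

Hypothesis hausX : hausdorff_space X.

Lemma paracompact_regular (D : set X) (x : X) : closed D -> ~ D x ->
  exists G, [/\ open G, G x & closure G `<=` ~` D].
Proof.
move=> clD nDx.
have [||G [oG DG Gx]] := @paracompact_separate D [set x] clD.
- exact/accessible_closed_set1/hausdorff_accessible.
- move=> c Dc; have cx : c != x by apply/eqP => cx; apply: nDx; rewrite -cx.
  move: hausX; rewrite open_hausdorff => /(_ _ _ cx)[[A B] /=].
  rewrite !inE => -[Ac Bx] [oA oB /disjoints_subset AB].
  exists A; split=> //; rewrite -subset0 => y [+ yx]; rewrite {}yx.
  by move=> /(_ B (open_nbhs_nbhs (conj oB Bx)))[z [/AB]].
exists (~` closure G); split.
- exact/closed_openC/closed_closure.
- by move=> clGx; have : (closure G `&` [set x]) x by []; rewrite Gx.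
- move=> y cly Dy.
  have [z [nz Gz]] := cly _ (open_nbhs_nbhs (conj oG (DG _ Dy))).
  by apply: nz; exact: subset_closure.
Qed.

Lemma paracompact_normal : normal_space X.
Proof.
move=> C clC D /set_nbhsP[U [oU CU UD]].
have [||G [oG CG GU]] := @paracompact_separate C (~` U) clC.
- exact: open_closedC.
- move=> c Cc; have [||Q [oO Oc OU]] := @paracompact_regular (~` U) c.
  + exact: open_closedC.
  + by move=> nUc; apply: nUc; exact: CU.
  by exists Q; split=> //; exact/disjoints_subset.
exists G; first by apply/set_nbhsP; exists G; split=> //; exact: subset_refl.
by move/disjoints_subset : GU; rewrite setCK => /subset_trans; apply.
Qed.

(** By regularity [U] has a refinement whose members have closures contained in
    members of [U]; these closures are united index by index. *)
Lemma closed_shrinking (I : choiceType) (U : I -> set X) :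
  open_family U -> covers U -> lf_family U ->
  exists F : I -> set X, [/\ closed_family F, covers F, lf_family F &
    forall i, F i `<=` U i].
Proof.
move=> oU cU lfU.
have /choice[Q QP] : forall x : X, exists iO : I * set X,
    [/\ open iO.2, iO.2 x & closure iO.2 `<=` U iO.1].
  move=> x; have [i Uix] := cU x.
  have [||Q [oO Ox OU]] := @paracompact_regular (~` U i) x.
  - exact/open_closedC.
  - by move=> nU; apply: nU.
  by exists (i, Q); split=> //; rewrite setCK in OU.
have [||W [oW cW lfW WO]] := @precise_refinement X (fun x => (Q x).2).
- by move=> x; have [] := QP x.
- by move=> x; exists x; have [] := QP x.
pose F i := \bigcup_(x in [set x | (Q x).1 = i]) closure (W x).
have FU i : F i `<=` U i.
  move=> y [x /= <- Wxy]; have [_ _ ] := QP x; apply.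
  exact: closureS Wxy.
exists F; split=> //.
- move=> i; apply: lf_closed_bigcup; last exact: lf_family_closure.
  by move=> x; exact: closed_closure.
- move=> y; have [x Wxy] := cW y; exists (Q x).1, x => //.
  exact: subset_closure.
- exact: lf_familyS lfU.
Qed.

End Paracompact.

(** For a closed shrinking [F] of [U] these sets cover the space, and the union
    of all those that contain a given point lies in a single member of [U]. *)
Definition barycentric (X I : Type) (U F : I -> set X) (z : X) : set X :=
  [set y | (forall i, F i z -> U i y) /\ (forall i, F i y -> F i z)].

Section Barycentric.
Context {X : topologicalType} {I : choiceType} (U F : I -> set X).
Hypotheses (oU : open_family U) (clF : closed_family F) (lfF : lf_family F).
Hypothesis FU : forall i, F i `<=` U i.

Lemma barycentric_open : open_family (barycentric U F).
Proof.
move=> z; rewrite (_ : barycentric U F z =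
  (\bigcap_(i in [set i | F i z]) U i) `&`
  ~` \bigcup_(i in [set i | ~ F i z]) F i).
  apply: openI; last exact/closed_openC/lf_closed_bigcup.
  have /finite_fsetP[A AE] := lf_family_point z lfF; rewrite AE.
  rewrite bigcap_fset; elim/big_ind : _ => //; first exact: openT.
  exact: openI.
apply/seteqP; split=> y /= [Uy Fy]; split=> //.
  by move=> [i /= nFiz /Fy].
by move=> i Fiy; apply: contrapT => nFiz; apply: Fy; exists i.
Qed.

Lemma barycentric_self z : barycentric U F z z.
Proof. by split=> // i /FU. Qed.

Lemma barycentric_sub z y i : barycentric U F z y -> F i y ->
  barycentric U F z `<=` U i.
Proof. by move=> [_ zy] /zy Fiz x [+ _]; exact. Qed.

End Barycentric.

(** The refinement [V] is barycentric enough that the members containing a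
    point [y] all lie in the neighbourhood [O x] of one point [x], which in turn
    lies in the members of [U] assigned to them by [r]. So [r] is a simplicial
    map between the nerves, and choices made for simplices of the nerve of [U]
    at [x] and valid on [O x] can be used for simplices of the nerve of [V]. *)
Lemma nerve_projection (X : topologicalType) (I : choiceType)
    (U : I -> set X) (O : X -> set X) :
  paracompact X -> hausdorff_space X ->
  open_family U -> covers U -> lf_family U ->
  open_family O -> (forall x, O x x) ->
  exists (V : X -> set X) (r : X -> I),
    [/\ open_family V, covers V, lf_family V, forall i, V i `<=` U (r i) &
    forall y, exists x, forall i, V i y -> V i `<=` O x /\ U (r i) x].
Proof.
move=> paraX hausX oU cU lfU oO OO.
have [F [clF cF lfF FU]] := closed_shrinking paraX hausX oU cU lfU.
have [||G [oG cG lfG GO]] :=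
    precise_refinement paraX (O := fun x => O x `&` barycentric U F x).
- by move=> x; apply: openI; [exact: oO|exact: barycentric_open].
- by move=> x; exists x; split; [exact: OO|exact: barycentric_self].
have [H [clH cH lfH HG]] := closed_shrinking paraX hausX oG cG lfG.
have [||V [oV cV lfV VB]] := precise_refinement paraX (O := barycentric G H).
- exact: barycentric_open.
- by move=> x; exists x; exact: barycentric_self.
(* [V i] need not contain [i], so [r i] is found through some point of [V i] *)
have /choice[r rP] : forall i, exists j, V i !=set0 -> V i `&` F j !=set0.
  move=> i; have [[y Vy]|nV] := pselect (V i !=set0).
    by have [j Fy] := cF y; exists j => _; exists y.
  by have [j _] := cF i; exists j.
have near_x y : exists x, forall i, V i y ->
    [/\ V i `<=` O x, V i `<=` barycentric U F x &
        barycentric U F x `<=` U (r i)].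
  have [x Hxy] := cH y; exists x => i Vy.
  have VG : V i `<=` G x.
    by move=> z Vz; apply: barycentric_sub Hxy _ (VB _ _ Vz); exact: VB.
  split=> [z /VG/GO[]//|z /VG/GO[]//|].
  have [|z [Vz Fz]] := rP i; first by exists y.
  by have [_ Bz] := GO _ _ (VG _ Vz); exact: barycentric_sub Bz Fz.
exists V, r; split=> // [i y Vy|y].
  by have [x /(_ _ Vy)[_ VB' BU]] := near_x y; exact/BU/VB'.
have [x xP] := near_x y; exists x => i /xP[VO _ BU].
by split=> //; apply: BU; exact: barycentric_self.
Qed.

(** * Covering dimension and locally finite covers *)

Definition isect (X : Type) (I : choiceType) (U : I -> set X) (s : {fset I}) :=
  [set x | forall i, i \in s -> U i x].

Section Dowker.
Context {X : topologicalType} {I : choiceType} (n : nat).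
Hypothesis dimX : covering_dim_le X n.
Implicit Types (U V : I -> set X) (s : {fset I}).

(** The members of [U] with index outside [s] are lumped together, which leaves
    a finite cover. A refinement of order at most [n] distributes its members
    among the indices in [s], and a point in the pieces of all of them would
    lie in at least [n.+2] different members. *)
Lemma finite_subcover_isect0 U s : open_family U -> covers U ->
  (n.+1 < #|` s|)%N ->
  exists V, [/\ open_family V, forall i, V i `<=` U i, isect V s = set0 &
    forall x, exists2 i, U i x & i \in s -> V i x].
Proof.
move=> oU cU ns.
pose O := \bigcup_(i in [set i | i \notin s]) U i.
have [||W [_ [oW cW] rW ordW]] := dimX (U := O |` (U @` [set` s])).
- by rewrite finite_setU; split; [exact: finite_set1|exact/finite_image].
- split=> [A [->|[i _ <-]]|]; [by apply: bigcup_open|exact: oU|].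
  rewrite -subTset => x _; have [i Uix] := cU x.
  have [si|nsi] := boolP (i \in s); last by exists O; [left|exists i].
  by exists (U i) => //; right; exists i.
have /choice[idx idxP] : forall B, exists o : option I, W B ->
    if o is Some i then i \in s /\ B `<=` U i else B `<=` O.
  move=> B; have [WB|nWB] := pselect (W B); last by exists None.
  have [_ [->|[i si <-]] BO] := rW _ WB; first by exists None.
  by exists (Some i).
exists (fun i => \bigcup_(B in [set B | W B /\ idx B = Some i]) B); split.
- by move=> i; apply: bigcup_open => B [/oW].
- by move=> i x [B [WB E] Bx]; have := idxP _ WB; rewrite E => -[_]; exact.
- rewrite -subset0 => x Vx.
  have /choice[B BP] : forall i, exists B, i \in s ->
      [/\ W B, idx B = Some i & B x].
    move=> i; have [si|] := boolP (i \in s); last by exists set0.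
    by have [B [WB E] Bx] := Vx _ si; exists B.
  have injB : {in [set` s] &, injective B}.
    move=> i j; rewrite !inE => si sj E.
    by have [_ + _] := BP _ si; rewrite E; have [_ -> _] := BP _ sj => -[].
  have : B @` [set` s] #<= `I_n.+1.
    apply: card_le_trans (ordW x); apply: subset_card_le => _ [i /= si <-].
    by have [] := BP _ si.
  have /card_eq_fsetP sE : #|` s| = #|` s| by [].
  rewrite (card_le_eql (inj_card_eq injB)) (card_le_eql sE) card_le_II.
  by rewrite leqNgt ns.
- move=> x; have : (\bigcup_(A in W) A) x by rewrite cW.
  move=> [B WB Bx]; have := idxP _ WB.
  case E : (idx B) => [i|]; last by move=> /(_ _ Bx)[i /negP nsi Uix]; exists i.
  by move=> [si BU]; exists i; [exact: BU|move=> _; exists B].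
Qed.

(** Only points near [isect U s] have to be removed from the members with index
   in [s]; this locality is what makes the reductions for infinitely many [s]
   compatible with each other. *)
Lemma shrink_isect0 U s : open_family U -> covers U -> (n.+1 < #|` s|)%N ->
  exists V, [/\ open_family V, covers V, forall i, V i `<=` U i,
    isect V s = set0 &
    forall x, ~ closure (isect U s) x -> forall i, U i x -> V i x].
Proof.
move=> oU cU ns.
have [V [oV VU V0 UV]] := finite_subcover_isect0 oU cU ns.
pose C := closure (isect U s).
exists (fun i => if i \in s then V i `|` (U i `&` ~` C) else U i); split.
- move=> i; case: ifP => _; last exact: oU.
  apply: openU; first exact: oV.
  by apply: openI; [exact: oU|exact/closed_openC/closed_closure].
- by move=> x; have [i Uix sV] := UV x; exists i; case: ifP => // /sV; left.
- by move=> i x; case: ifP => // _ [/VU|[]].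
- rewrite -subset0 => x Vx.
  have Cx : C x.
    apply: subset_closure => i si; have := Vx i si; rewrite si.
    by move=> [/VU|[]].
  suff : isect V s x by rewrite V0.
  by move=> i si; have := Vx i si; rewrite si => -[|[]].
- by move=> x nCx i Uix; case: ifP => // _; right.
Qed.

Section Reductions.
Variable U : I -> set X.
Hypotheses (oU : open_family U) (cU : covers U) (lfU : lf_family U).

(** A partial reduction records the index sets [s] already treated and the
    shrinking of [U] obtained so far. *)
Definition reduction (t : set {fset I} * (I -> set X)) :=
  [/\ open_family t.2, covers t.2, forall i, t.2 i `<=` U i &
    forall s, t.1 s -> isect t.2 s = set0].

(** The last clause says that points are removed only near the common
    intersections that are treated by [t'] but not yet by [t]. *)
Definition reduces (t t' : set {fset I} * (I -> set X)) :=
  [/\ t.1 `<=` t'.1, forall i, t'.2 i `<=` t.2 i &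
    forall x, (forall s, t'.1 s -> closure (isect U s) x -> t.1 s) ->
      forall i, t.2 i x -> t'.2 i x].

Implicit Types t : set {fset I} * (I -> set X).

Lemma reduces_refl t : reduces t t.
Proof. by split=> [|i|//]; exact: subset_refl. Qed.

Lemma reduces_trans t1 t2 t3 : reduces t1 t2 -> reduces t2 t3 -> reduces t1 t3.
Proof.
move=> [S12 V12 E12] [S23 V23 E23]; split.
- exact: subset_trans S12 S23.
- by move=> i; exact: subset_trans (V23 i) (V12 i).
- move=> x x13 i tix; apply: E23.
    by move=> s ts cx; apply: S12; exact: x13.
  by apply: E12 => // s ts cx; apply: x13 => //; exact: S23.
Qed.

(** This is where local finiteness is used: a neighbourhood of [x] that meets
    only the [U i] with [i] in a finite set is affected only by the finitely
    many [s] inside that set, so the chain is stationary there. *)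
Lemma reduction_chain_stationary (A : set (set {fset I} * (I -> set X)))
    (x : X) :
  A !=set0 -> total_on A reduces ->
  exists N t, [/\ open N, N x, A t &
    forall t', A t' -> forall i y, N y -> t.2 i y -> t'.2 i y].
Proof.
move=> [t0 At0] totA; have [N xN finN] := lfU x.
have /finite_fsetP[J JE] := finN.
have [t At tP] : exists2 t, A t & forall s, s \in fpowerset J ->
    forall t', A t' -> t'.1 s -> t.1 s.
  suff main (l : seq {fset I}) : exists2 t, A t &
      forall s, s \in l -> forall t', A t' -> t'.1 s -> t.1 s.
    exact: (main (enum_fset (fpowerset J))).
  elim: l => [|s l [t At IH]]; first by exists t0.
  have [[t' [At' t's]]|nt'] := pselect (exists t', A t' /\ t'.1 s).
    have [tt'|t't] := totA _ _ At At'.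
      exists t' => // u; rewrite inE => /orP[/eqP ->|ul] t'' At'' t''u //.
      by have [+ _ _] := tt'; apply; exact: IH t''u.
    exists t => // u; rewrite inE => /orP[/eqP ->|ul] t'' At'' t''u.
      by have [+ _ _] := t't; apply.
    exact: IH t''u.
  exists t => // u; rewrite inE => /orP[/eqP ->|ul] t'' At'' t''u.
    by case: nt'; exists t''.
  exact: IH t''u.
exists N°, t; split=> //; first exact: open_interior.
move=> t' At' i y Ny tiy.
have [[_ _ tt']|[_ t't _]] := totA _ _ At At'; last exact: t't.
apply: tt' => // s t's cly; apply: (tP s _ t') => //.
rewrite fpowersetE; apply/fsubsetP => j js.
have [z [Uz Nz]] := cly _ Ny.
have : [set` J] j by rewrite -JE; exists z; split=> //; exact: Uz.
by [].
Qed.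

Lemma reduction_chain_bound (A : set (set {fset I} * (I -> set X))) :
  A !=set0 -> A `<=` reduction -> total_on A reduces ->
  exists2 t, reduction t & forall t', A t' -> reduces t' t.
Proof.
move=> A0 Ared totA; have stat x := reduction_chain_stationary x A0 totA.
exists (\bigcup_(t in A) t.1, fun i => \bigcap_(t in A) t.2 i).
  split=> /=.
  - move=> i; rewrite openE => x Vx; have [N [t [oN Nx At NP]]] := stat x.
    have [ot _ _ _] := Ared _ At.
    apply: (@filterS _ _ _ (N `&` t.2 i)).
      by move=> y [Ny tiy] t' At'; exact: NP tiy.
    by apply: open_nbhs_nbhs; split; [exact: openI|split=> //; exact: Vx].
  - move=> x; have [N [t [oN Nx At NP]]] := stat x.
    have [_ ct _ _] := Ared _ At; have [i tix] := ct x.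
    by exists i => t' At'; exact: NP tix.
  - move=> i x Vx; have [t At] := A0; have [_ _ + _] := Ared _ At.
    by apply; exact: Vx.
  - move=> s [t At ts]; rewrite -subset0 => x Vx.
    have [_ _ _ /(_ _ ts) <-] := Ared _ At.
    by move=> i si; exact: Vx.
move=> t At; split=> /=.
- by move=> s ts; exists t.
- by move=> i x; exact.
- move=> x xt i tix t' At'.
  have [[_ _ tt']|[_ t't _]] := totA _ _ At At'; last exact: t't.
  by apply: tt' => // s t's; apply: xt; exists t'.
Qed.

(** Dowker's theorem that covering dimension, defined by finite covers, also
    bounds the order of suitable shrinkings of locally finite covers. *)
Lemma dim_le_shrinking :
  exists V, [/\ open_family V, covers V, forall i, V i `<=` U i &
    forall s, isect V s !=set0 -> (#|` s| <= n.+1)%N].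
Proof.
pose T := {t | reduction t}.
have red0 : reduction (set0, U) by split=> //= i; exact: subset_refl.
pose t0 : T := exist _ _ red0.
pose leT (s t : T) := `[< reduces (sval s) (sval t) >].
have [||A totA|t tmax] := @ZL_preorder T t0 leT.
- by move=> t; apply/asboolP; exact: reduces_refl.
- move=> r s t /asboolP rs /asboolP st; apply/asboolP.
  exact: reduces_trans st.
- have [[t1 At1]|A0] := pselect (A !=set0); last first.
    by exists t0 => t At; case: A0; exists t.
  have [|||t tred tP] := @reduction_chain_bound (sval @` A).
  + by exists (sval t1), t1.
  + by move=> _ [t _ <-]; exact: svalP.
  + move=> _ _ [s As <-] [t At <-].
    by have [/asboolP|/asboolP] := totA _ _ As At; [left|right].
  exists (exist _ t tred) => s As; apply/asboolP; apply: tP.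
  by exists s.
case: t tmax => -[S V] /= red tmax; have [/= oV cV VU SV] := red.
exists V; split=> // s [x Vsx]; rewrite leqNgt; apply/negP => ns.
suff Ss : S s by have := SV _ Ss; rewrite -subset0 => /(_ x Vsx).
have [V' [oV' cV' V'V V'0 V'eq]] := shrink_isect0 oV cV ns.
have red' : reduction (S `|` [set s], V').
  split=> //= [i|u]; first exact: subset_trans (V'V i) (VU i).
  move=> [/SV|->//]; rewrite -!subset0 => Vu0 y V'uy; apply: (Vu0 y).
  by move=> i ui; apply: V'V; exact: V'uy.
have : leT (exist _ _ red') (exist _ _ red).
  apply: tmax; apply/asboolP; split=> /= [u Su|//|y Sy i Viy]; first by left.
  have nSs : ~ S s.
    by move=> Ss; have := SV _ Ss; rewrite -subset0 => /(_ x Vsx).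
  apply: V'eq => // cly; apply: nSs; apply: Sy; first by right.
  by apply: closureS cly => z Vz j sj; apply: VU; exact: Vz.
by move=> /asboolP[+ _ _] => /=; apply; right.
Qed.

End Reductions.

End Dowker.

(** * Convergence of finite expressions and of families *)

Lemma cvg_bigop (R : realType) (T : Type) (F : set_system T) (J : Type)
    (r : seq J) (op : R -> R -> R) (idx : R) (f : J -> T -> R) (l : J -> R) :
  Filter F -> continuous (fun z : R * R => op z.1 z.2) ->
  (forall j, f j @ F --> l j) ->
  (fun t => \big[op/idx]_(j <- r) f j t) @ F --> \big[op/idx]_(j <- r) l j.
Proof.
move=> FF cop fl; elim: r => [|j r IH].
  rewrite big_nil; under eq_fun do rewrite big_nil; exact: cvg_cst.
rewrite big_cons; under eq_fun do rewrite big_cons.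
exact: continuous2_cvg (cop (l j, _)) (fl j) IH.
Qed.

Lemma cvg_sumr (R : realType) (T : Type) (F : set_system T) (J : Type)
    (r : seq J) (f : J -> T -> R) (l : J -> R) :
  Filter F -> (forall j, f j @ F --> l j) ->
  (fun t => \sum_(j <- r) f j t) @ F --> \sum_(j <- r) l j.
Proof. by move=> FF; apply: cvg_bigop => z; exact: add_continuous. Qed.

Lemma cvg_ptws (R : realType) (T I : Type) (F : set_system T)
    (f : T -> {ptws I -> R}) (l : {ptws I -> R}) :
  Filter F -> (forall i, (fun t => f t i) @ F --> l i) -> f @ F --> l.
Proof.
move=> FF fl; apply/cvg_sup => i U [V [[W oW <-] Wl WU]].
apply: filterS WU _; apply: (fl i).
by apply: open_nbhs_nbhs; split.
Qed.

Lemma ptws_coord_cvg (R : realType) (I : choiceType) (A : set {ptws I -> R})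
    (w : {ptws I -> R}) (i : I) :
  (fun v : {ptws I -> R} => v i) @ within A (nbhs w) --> w i.
Proof.
apply: cvg_within_filter; exact: (@proj_continuous I (fun=> R) i w).
Qed.

Lemma cvg_rV (R : realType) (T : Type) (F : set_system T) (m : nat)
    (f : T -> 'rV[R]_m) (l : 'rV[R]_m) :
  Filter F -> (forall j, (fun t => f t ord0 j) @ F --> l ord0 j) -> f @ F --> l.
Proof.
move=> FF fl U [P lP PU]; rewrite nbhs_simpl /=.
apply: (filterS (P := [set t | forall j, P ord0 j (f t ord0 j)])).
  by move=> t Pt; apply: PU => i j; rewrite ord1.
apply: filter_forall => j; exact: fl (lP _ _).
Qed.

Lemma within_continuousP (T U : topologicalType) (A : set T) (f : T -> U) :
  {within A, continuous f} <->
  forall x, A x -> f @ within A (nbhs x) --> f x.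
Proof. exact: subspace_continuousP. Qed.

Lemma within_comp_continuous (T U V : topologicalType) (A : set T) (B : set U)
    (f : T -> U) (g : U -> V) :
  {within A, continuous f} -> f @` A `<=` B -> {within B, continuous g} ->
  {within A, continuous (g \o f)}.
Proof.
move=> /within_continuousP cf fAB /within_continuousP cg.
apply/within_continuousP => x Ax; have Bfx : B (f x) by apply: fAB; exists x.
move=> N /(cg _ Bfx); rewrite nbhs_simpl /within /= => gN.
rewrite nbhs_simpl /within /=.
have := cf x Ax _ gN; rewrite nbhs_simpl /within /=.
apply: (@filterS _ (nbhs x)) => y + Ay => /(_ Ay); apply.
by apply: fAB; exists y.
Qed.

(** * Partitions of unity *)

Section PartitionOfUnity.
Context {R : realType} {X : topologicalType} {I : choiceType}.
Hypotheses (paraX : paracompact X) (hausX : hausdorff_space X).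

(** The sum of the infinite family is expressed through arbitrary finite sets of
    indices containing all nonzero terms; locally one such set serves for all
    points at once. *)
Lemma partition_of_unity (V : I -> set X) :
  open_family V -> covers V -> lf_family V ->
  exists h : I -> X -> R, [/\ forall i, continuous (h i),
    forall i x, 0 <= h i x, forall i x, h i x != 0 -> V i x &
    forall x (A : {fset I}), (forall i, h i x != 0 -> i \in A) ->
      \sum_(i <- A) h i x = 1].
Proof.
move=> oV cV lfV.
have [F [clF cF lfF FV]] := closed_shrinking paraX hausX oV cV lfV.
have sepF i : uniform_separator (~` V i) (F i).
  apply: ((@normal_separatorP R X).1 (paracompact_normal paraX hausX)).
  - exact: open_closedC.
  - exact: clF.
  - by apply/disjoints_subset/subsetC => x /FV.
pose g i : X -> R := Urysohn (~` V i) (F i).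
have cg i : continuous (g i) by exact: Urysohn_continuous.
have g0 i x : 0 <= g i x.
  have : `[0, 1]%classic (g i x) by apply: Urysohn_range; exists x.
  by rewrite /= in_itv /= => /andP[].
have gV i x : g i x != 0 -> V i x.
  move=> gx; apply: contrapT => nVx; move/eqP: gx; apply.
  by apply: (Urysohn_sub0 (sepF i)); exists x.
have gF i x : F i x -> g i x = 1.
  by move=> Fx; apply: (Urysohn_sub1 (sepF i)); exists x.
pose S x := \sum_(i <- members V x) g i x.
have SE x (A : {fset I}) : (forall i, g i x != 0 -> i \in A) ->
    \sum_(i <- A) g i x = S x.
  move=> gA; rewrite /S.
  transitivity (\sum_(i <- (A `|` members V x)%fset) g i x).
    apply: big_fset_incl; first exact: fsubsetUl.
    by move=> i _ /negP nAi; apply/eqP/negP => /negP/gA.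
  symmetry; apply: big_fset_incl; first exact: fsubsetUr.
  by move=> i _; apply: contraNeq => /gV/(membersP _ _ lfV).
have S_gt0 x : 0 < S x.
  have [i Fix] := cF x.
  have Vi : i \in members V x by apply/membersP => //; exact: FV.
  rewrite /S (big_fsetD1 i)//= gF// ltr_pwDl//.
  by rewrite sumr_ge0.
have cS : continuous S.
  move=> x; have [N xN /finite_fsetP[A AE]] := lfV x.
  have SN y : N y -> S y = \sum_(i <- A) g i y.
    move=> Ny; rewrite SE// => i /gV Viy.
    by have : [set` A] i by rewrite -AE; exists y.
  rewrite /continuous_at SN; last exact: nbhs_singleton.
  apply: (@cvg_trans _ ((fun y => \sum_(i <- A) g i y) @ x)).
    by apply: near_eq_cvg; apply: filterS xN => y /SN.
  by apply: cvg_sumr => i; exact: cg.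
exists (fun i x => g i x / S x); split.
- move=> i x; apply: cvgM; first exact: cg.
  by apply: cvgV; [rewrite gt_eqF|exact: cS].
- by move=> i x; rewrite divr_ge0// ltW.
- by move=> i x; rewrite mulf_eq0 negb_or => /andP[/gV].
- move=> x A hA; rewrite -mulr_suml SE ?divff ?gt_eqF// => i gi.
  by apply: hA; rewrite mulf_neq0// invr_eq0 gt_eqF.
Qed.

End PartitionOfUnity.

(** * The Euclidean ball as a simplex *)

Section BallSimplex.
Context {R : realType} {k : nat}.
Implicit Types (v : 'rV[R]_k.+1) (b : 'I_k.+2 -> R).

Lemma sqnorm_ge0 v : 0 <= sqnorm v.
Proof. by apply: sumr_ge0 => i _; exact: sqr_ge0. Qed.

Lemma sqnorm_eq0 v : sqnorm v = 0 -> v = 0.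
Proof.
move=> /psumr_eq0P v0; apply/rowP => j; rewrite mxE.
by apply/eqP; rewrite -sqrf_eq0; apply/eqP/v0 => // i _; exact: sqr_ge0.
Qed.

Lemma sqnormZ (a : R) v : sqnorm (a *: v) = a ^+ 2 * sqnorm v.
Proof. by rewrite mulr_sumr; apply: eq_bigr => i _; rewrite mxE exprMn. Qed.

Lemma cvg_sqnorm (T : Type) (F : set_system T) (f : T -> 'rV[R]_k.+1) v :
  Filter F -> (forall j, (fun t => f t ord0 j) @ F --> v ord0 j) ->
  (fun t => sqnorm (f t)) @ F --> sqnorm v.
Proof.
move=> FF fv; apply: cvg_sumr => j.
under eq_fun do rewrite expr2; rewrite expr2; exact: cvgM.
Qed.

Lemma ball_compact : compact (unit_ball R k.+1).
Proof.
apply: bounded_closed_compact.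
  exists 1; split=> // M M1 v /= v1.
  rewrite [leLHS]/Num.norm /= mx_normrE.
  apply/bigmax_leP; split=> [|[i j] _ /=].
    by rewrite (le_trans ler01)// ltW.
  apply: le_trans (ltW M1); rewrite ord1 -(ler_sqr _ _) ?nnegrE// expr1n.
  rewrite real_normK ?num_real// (le_trans _ v1)// /sqnorm (bigD1 j)//= lerDl.
  by apply: sumr_ge0 => i' _; exact: sqr_ge0.
have -> : unit_ball R k.+1 = @sqnorm R k.+1 @^-1` [set x | x <= 1] by [].
apply: (@preimage_closed 'rV[R]_k.+1 R); last exact: closed_le.
move=> v _; apply: (@cvg_sqnorm _ (nbhs v) id) => j; exact: coord_continuous.
Qed.

(** The hyperplane of vectors of ['I_k.+2 -> R] with zero sum is parametrized
    by ['rV_k.+1] by forgetting the last coordinate. *)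
Definition zerosum v (j : 'I_k.+2) : R :=
  if unlift ord_max j is Some i then v ord0 i else - \sum_i v ord0 i.

Lemma sum_zerosum v : \sum_j zerosum v j = 0.
Proof.
rewrite big_ord_recr /= /zerosum unlift_none; apply/eqP.
rewrite subr_eq0; apply/eqP/eq_bigr => i _.
rewrite (_ : widen_ord _ i = lift ord_max i) ?liftK//; apply: val_inj.
by rewrite /= /bump leqNgt ltn_ord.
Qed.

Lemma zerosumZ (a : R) v j : zerosum (a *: v) j = a * zerosum v j.
Proof.
rewrite /zerosum; case: unlift => [i|]; first by rewrite mxE.
by rewrite mulrN mulr_sumr; congr (- _); apply: eq_bigr => i _; rewrite mxE.
Qed.

Lemma cvg_zerosum (T : Type) (F : set_system T) (f : T -> 'rV[R]_k.+1) v j :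
  Filter F -> (forall j, (fun t => f t ord0 j) @ F --> v ord0 j) ->
  (fun t => zerosum (f t) j) @ F --> zerosum v j.
Proof.
move=> FF fv; rewrite /zerosum; case: unlift => [i|]; first exact: fv.
by apply: cvgN; apply: cvg_sumr.
Qed.

Lemma zerosum_row (c : R) b : c *+ k.+2 = 1 -> \sum_j b j = 1 ->
  zerosum (\row_i (b (lift ord_max i) - c)) =1 (fun j => b j - c).
Proof.
move=> ck b1 j; rewrite /zerosum; case: unliftP => [i ->|->].
  by rewrite mxE.
transitivity (- (\sum_(i < k.+1) b (lift ord_max i) - c *+ k.+1)).
  congr (- _); under eq_bigr do rewrite mxE.
  by rewrite big_split /= sumr_const card_ord mulNrn.
move: b1; rewrite big_ord_recr /= => b1.
have -> : \sum_(i < k.+1) b (lift ord_max i) = 1 - b ord_max.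
  rewrite -b1 addrK; apply: eq_bigr => i _; congr b.
  by apply: val_inj; rewrite /= /bump leqNgt ltn_ord.
by rewrite -[in 1 - _]ck mulrS; ring.
Qed.

(** With its barycentre moved to the origin, the simplex consists of the
    zero-sum vectors of gauge at most [k.+2%:R^-1], and its boundary of those
    for which equality holds. *)
Definition gauge v : R := \big[Num.max/0]_j (- zerosum v j).

Lemma gauge_ge v j : - zerosum v j <= gauge v.
Proof. exact: le_bigmax. Qed.

Lemma gauge_gt0 v : v != 0 -> 0 < gauge v.
Proof.
move=> v0; rewrite lt_neqAle eq_sym bigmax_ge_id andbT.
apply: contra_neqN v0 => /eqP g0.
have zge j : 0 <= zerosum v j by have := gauge_ge v j; rewrite g0 oppr_le0.
have /psumr_eq0P z0 := sum_zerosum v.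
apply/rowP => i; rewrite mxE.
by have := z0 (fun j _ => zge j) (lift ord_max i) isT; rewrite /zerosum liftK.
Qed.

Lemma gaugeZ (a : R) v : 0 <= a -> gauge (a *: v) = a * gauge v.
Proof.
move=> a0; rewrite /gauge; under eq_bigr do rewrite zerosumZ -mulrN.
elim/big_ind2 : _ => [|x1 x2 y1 y2 -> ->|//]; first by rewrite mulr0.
by rewrite maxr_pMr.
Qed.

Lemma gauge_attained v : v != 0 -> exists j, - zerosum v j = gauge v.
Proof.
move=> v0; apply: contrapT => /forallNP nj.
suff : gauge v < gauge v by rewrite ltxx.
rewrite {1}/gauge; apply/bigmax_ltP; split; first exact: gauge_gt0.
by move=> j _; rewrite lt_neqAle gauge_ge andbT; apply/eqP.
Qed.

Lemma cvg_gauge (T : Type) (F : set_system T) (f : T -> 'rV[R]_k.+1) v :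
  Filter F -> (forall j, (fun t => f t ord0 j) @ F --> v ord0 j) ->
  (fun t => gauge (f t)) @ F --> gauge v.
Proof.
move=> FF fv; apply: cvg_bigop.
  by move=> z; exact: max_continuous.
by move=> j; apply: cvgN; exact: cvg_zerosum.
Qed.

End BallSimplex.

(** * Simplices *)

Section Simplex.
Context {R : realType} {I : choiceType}.
Implicit Types (s t : {fset I}) (w : {ptws I -> R}).

(** The product topology on all families of weights induces the Euclidean
    topology on each simplex, so that one ambient space serves for the whole
    nerve, even if the nerve is infinite. *)
Definition simplex s : set {ptws I -> R} :=
  [set w | [/\ forall i, 0 <= w i, forall i, i \notin s -> w i = 0 &
               \sum_(i <- s) w i = 1]].

Definition boundary s : set {ptws I -> R} :=
  simplex s `&` [set w | exists2 i, i \in s & w i = 0].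

Lemma fset_enumeration s m : #|` s| = m.+1 ->
  exists (e : 'I_m.+1 -> I) (r : I -> 'I_m.+1), [/\ forall j, e j \in s,
    cancel e r, {in s, cancel r e} &
    forall F : I -> R, \sum_(i <- s) F i = \sum_j F (e j)].
Proof.
move=> sm; have [i0 _] : exists i, i \in s.
  by case: (fset_0Vmem s) sm => [->|[i si] _]; [rewrite cardfs0|exists i].
exists (fun j => nth i0 s j), (fun i => inord (index i s)); split.
- by move=> j; rewrite mem_nth// sm.
- by move=> j; rewrite index_uniq ?fset_uniq ?sm// inord_val.
- by move=> i si; rewrite inordK ?nth_index// -sm index_mem.
- by move=> F; rewrite (big_nth i0) sm big_mkord.
Qed.

(** A map on the boundary of a simplex is transported to the sphere by the
    radial projection [h] of the sphere onto the boundary. The map [q] pulling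
    the extension back need only be inverse to [h] on the boundary; dividing by
    the maximum of the norm and the product of the weights, which vanishes
    exactly on the boundary, makes it continuous at the barycentre as well. The
    compact set [K] is the image of the ball. *)
Lemma simplex_extension (Y : topologicalType) k (S B : set Y) s
    (f : {ptws I -> R} -> Y) :
  #|` s| = k.+2 -> sphere_extends R k S B ->
  {within boundary s, continuous f} -> f @` boundary s `<=` S ->
  exists (g : {ptws I -> R} -> Y) (K : set Y),
    [/\ {within simplex s, continuous g}, compact K, K `<=` B,
        g @` simplex s `<=` K & forall w, boundary s w -> g w = f w].
Proof.
move=> sk SB cf fS; have [e [r [es er re sume]]] := fset_enumeration sk.
(* the weights of the barycentre *)
pose c : R := k.+2%:R^-1.
have c_gt0 : 0 < c by rewrite invr_gt0 ltr0n.
have ck : c *+ k.+2 = 1 by rewrite -mulr_natr mulVf// pnatr_eq0.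
pose h (v : 'rV[R]_k.+1) : {ptws I -> R} := fun i =>
  if i \in s then c + c * (zerosum v (r i) / gauge v) else 0.
pose u w : 'rV[R]_k.+1 := \row_i (w (e (lift ord_max i)) - c).
pose den w : R := Num.max (Num.sqrt (sqnorm (u w))) (\prod_j w (e j)).
pose q w : 'rV[R]_k.+1 := (den w)^-1 *: u w.
have nz v : unit_sphere R k v -> v != 0.
  rewrite /unit_sphere /= => v1; apply/eqP => v0; move: v1.
  rewrite v0 /sqnorm big1 => [/esym/eqP|i _]; first by rewrite oner_eq0.
  by rewrite mxE expr0n.
have hbd v : unit_sphere R k v -> boundary s (h v).
  move=> /nz v0; have g0 := gauge_gt0 v0; split; first split.
  - move=> i; rewrite /h; case: ifP => // _.
    rewrite -[X in X + _]mulr1 -mulrDr mulr_ge0 ?(ltW c_gt0)//.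
    by rewrite -lerBlDl sub0r ler_pdivlMr// mulN1r lerNl gauge_ge.
  - by move=> i /negPf; rewrite /h => ->.
  - rewrite sume (eq_bigr (fun j => c + c * (zerosum v j / gauge v))).
      rewrite big_split /= sumr_const card_ord ck -mulr_sumr -mulr_suml.
      by rewrite sum_zerosum mul0r mulr0 addr0.
    by move=> j _; rewrite /h es er.
  - have [j vj] := gauge_attained v0; exists (e j); first exact: es.
    rewrite /h es er -vj invrN mulrN divff ?mulrN1 ?subrr//.
    by rewrite -oppr_eq0 vj gt_eqF.
have ch : {within unit_sphere R k,
    continuous (h : 'rV[R]_k.+1 -> {ptws I -> R})}.
  apply/within_continuousP => v v1; apply: cvg_ptws => i; rewrite /h.
  have vj (j : 'I_k.+1) :
      (fun t : 'rV[R]_k.+1 => t ord0 j) @ within (unit_sphere R k) (nbhs v) -->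
      v ord0 j.
    by apply: cvg_within_filter; exact: coord_continuous.
  case: (i \in s); last exact: cvg_cst.
  apply: cvgD; first exact: cvg_cst.
  apply: cvgM; first exact: cvg_cst.
  apply: cvgM; first exact: (@cvg_zerosum _ _ _ _ id).
  apply: cvgV; first by rewrite gt_eqF// gauge_gt0// nz.
  exact: (@cvg_gauge _ _ _ _ id).
have uE w : simplex s w -> zerosum (u w) =1 (fun j => w (e j) - c).
  move=> [_ _ w1]; apply: (zerosum_row (b := fun j => w (e j))) => //.
  by rewrite -sume.
have u0 w : simplex s w -> u w = 0 -> forall j, w (e j) = c.
  move=> sw uw j; have := uE w sw j; rewrite uw -(scale0r 0) zerosumZ mul0r.
  by move=> /esym/eqP; rewrite subr_eq0 => /eqP.
have den_gt0 w : simplex s w -> 0 < den w.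
  move=> sw; rewrite lt_max; apply/orP.
  have [uw|uw] := eqVneq (u w) 0; [right|left].
    by apply: prodr_gt0 => j _; rewrite u0.
  rewrite sqrtr_gt0 lt_neqAle sqnorm_ge0 andbT eq_sym.
  by apply: contra_neq uw; exact: sqnorm_eq0.
have qball w : simplex s w -> unit_ball R k.+1 (q w).
  move=> sw; have d0 := den_gt0 w sw.
  rewrite /unit_ball /= sqnormZ exprVn mulrC ler_pdivrMr ?exprn_gt0//.
  rewrite mul1r -[leLHS]sqr_sqrtr ?sqnorm_ge0//.
  by rewrite ler_sqr ?nnegrE ?sqrtr_ge0 ?(ltW d0)// le_max lexx.
have bd_den w : boundary s w -> den w = Num.sqrt (sqnorm (u w)).
  move=> [_ [i si wi]]; rewrite /den (bigD1 (r i))//= re// wi mul0r.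
  by rewrite max_l// sqrtr_ge0.
have qsphere w : boundary s w -> unit_sphere R k (q w).
  move=> bw; have := den_gt0 w bw.1; rewrite /unit_sphere /= sqnormZ bd_den//.
  rewrite sqrtr_gt0 => d0.
  by rewrite exprVn sqr_sqrtr ?sqnorm_ge0// mulVf// gt_eqF.
have hq w : boundary s w -> h (q w) = w.
  move=> bw; have [sw [i0 si0 wi0]] := bw; have d0 := den_gt0 w sw.
  have gu : gauge (u w) = c.
    apply/eqP; rewrite eq_le; apply/andP; split.
      apply/bigmax_leP; split=> [|j _]; first exact: ltW.
      by rewrite uE// opprB gerBl; case: sw.
    by rewrite (le_trans _ (gauge_ge _ (r i0)))// uE// re// wi0 sub0r opprK.
  apply/funext => i; rewrite /h; case: ifPn => [si|nsi]; last first.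
    by case: sw => _ ->.
  rewrite zerosumZ gaugeZ ?invr_ge0 ?(ltW d0)// uE// re// gu.
  have dn0 : den w != 0 by rewrite gt_eqF.
  have cn0 : c != 0 by rewrite gt_eqF.
  by clearbody c; field; rewrite dn0.
have cq : {within simplex s, continuous (q : {ptws I -> R} -> 'rV[R]_k.+1)}.
  apply/within_continuousP => w sw.
  have uj (j : 'I_k.+1) :
      (fun w' => u w' ord0 j) @ within (simplex s) (nbhs w) --> u w ord0 j.
    have -> : (fun w' => u w' ord0 j) = (fun w' => w' (e (lift ord_max j)) - c).
      by apply/funext => w'; rewrite mxE.
    rewrite mxE; apply: cvgB; [exact: ptws_coord_cvg|exact: cvg_cst].
  apply: cvg_rV => j; rewrite mxE.
  have -> : (fun w' => q w' ord0 j) = (fun w' => (den w')^-1 * u w' ord0 j).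
    by apply/funext => w'; rewrite mxE.
  apply: cvgM => //; apply: cvgV; first by rewrite gt_eqF// den_gt0.
  apply: (@continuous2_cvg _ R R R _ _ _ _ (Num.max : R -> R -> R)).
  - exact: (@max_continuous _ R (_, _)).
  - apply: continuous_cvg; first exact: sqrt_continuous.
    exact: cvg_sqnorm.
  - apply: cvg_bigop => [z|j']; first exact: mul_continuous.
    exact: ptws_coord_cvg.
have [||G [cG GB Gf]] := SB (f \o h).
- apply: within_comp_continuous ch _ cf => _ [v v1 <-].
  exact: hbd.
- by move=> _ [v v1 <-]; apply: fS; exists (h v) => //; exact: hbd.
exists (G \o q), (G @` unit_ball R k.+1); split=> //.
- by apply: within_comp_continuous cq _ cG => _ [w sw <-]; exact: qball.
- exact: continuous_compact cG ball_compact.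
- by move=> _ [w sw <-]; exists (q w) => //; exact: qball.
- by move=> w bw /=; rewrite Gf ?hq//=; [rewrite hq|exact: qsphere].
Qed.

End Simplex.

(** * Maps on simplicial complexes *)

Section Carrier.
Context {R : realType} {I : choiceType}.
Implicit Types (s t : {fset I}) (w : {ptws I -> R}).

Lemma simplexS s t : (t `<=` s)%fset -> @simplex R I t `<=` simplex s.
Proof.
move=> ts w [w0 wt w1]; split=> // [i nsi|].
  by apply: wt; apply: contra nsi; exact: (fsubsetP ts).
by rewrite -w1; symmetry; apply: big_fset_incl => // i _; exact: wt.
Qed.

Definition carrier s w : {fset I} := [fset i in s | w i != 0]%fset.

Lemma in_carrier s w i : (i \in carrier s w) = (i \in s) && (w i != 0).
Proof. by rewrite !inE. Qed.

Lemma carrier_sub s w : (carrier s w `<=` s)%fset.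
Proof. by apply/fsubsetP => i; rewrite in_carrier => /andP[]. Qed.

Lemma simplex_carrier s w : simplex s w -> simplex (carrier s w) w.
Proof.
move=> [w0 ws w1]; split=> // [i|].
  by rewrite in_carrier negb_and negbK => /orP[/ws|/eqP].
rewrite -w1; apply: big_fset_incl; first exact: carrier_sub.
by move=> i si; rewrite in_carrier si /= negbK => /eqP.
Qed.

Lemma carrier_minimal s t w : simplex t w -> (carrier s w `<=` t)%fset.
Proof.
move=> [_ wt _]; apply/fsubsetP => i; rewrite in_carrier => /andP[_].
by apply: contra_neqT => /wt.
Qed.

Lemma boundary_carrier s w : boundary s w -> (carrier s w `<` s)%fset.
Proof.
move=> [sw [i si wi]]; rewrite fproperE carrier_sub /=.
by apply/fsubsetPn; exists i; rewrite // in_carrier wi eqxx andbF.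
Qed.

Lemma proper_boundary s t w : (t `<` s)%fset -> simplex t w -> boundary s w.
Proof.
move=> ts tw; split; first exact: simplexS (fproper_sub ts) _ tw.
move: ts; rewrite fproperE => /andP[_ /fsubsetPn[i si ti]].
by exists i => //; case: tw => _ + _; apply.
Qed.

Variable Y : topologicalType.
Implicit Types p : {fset I} -> {ptws I -> R} -> Y.

Definition compatible p s :=
  forall t w, (t `<=` s)%fset -> simplex t w -> p s w = p t w.

(** The maps [p s] are glued along a map [lam] into a finite complex. Near [x]
    the carrier takes finitely many values [s], each of which contains the
    carrier at [x]. On the part where it equals [s] the glued map is given by
    [p s], which is continuous and by compatibility has at [lam x] the value of
    the glued map. *)
Lemma carrier_glue (T : topologicalType) (D : set T) (lam : T -> {ptws I -> R})
    (A : {fset I}) p (x : T) :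
  D x -> {within D, continuous lam} ->
  (forall y, D y -> [/\ simplex A (lam y),
    {within simplex (carrier A (lam y)), continuous p (carrier A (lam y))} &
    compatible p (carrier A (lam y))]) ->
  (fun y => p (carrier A (lam y)) (lam y)) @ within D (nbhs x) -->
    p (carrier A (lam x)) (lam x).
Proof.
move=> Dx /within_continuousP clam DP W Wx; rewrite nbhs_simpl /=.
have FF : Filter (within D (nbhs x)) by exact: within_filter.
pose P (s : {fset I}) : set T := [set y | D y -> carrier A (lam y) = s ->
  W (p (carrier A (lam y)) (lam y))].
suff : within D (nbhs x) (\bigcap_(s in [set` fpowerset A]) P s).
  rewrite /within /=; apply: (@filterS _ (nbhs x)) => y Py Dy.
  by apply: (Py Dy (carrier A (lam y))) => //=; rewrite fpowersetE carrier_sub.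
apply: filter_bigI => s _; rewrite /P.
have [[y0 [Dy0 y0s]]|ns] := pselect (exists y, D y /\ carrier A (lam y) = s);
    last first.
  by apply: filterE => y Dy ys; case: ns; exists y.
have [Ay0 cps comps] := DP _ Dy0; rewrite y0s in cps comps.
have [Ax _ _] := DP _ Dx.
have [xs|/fsubsetPn[i]] := boolP (carrier A (lam x) `<=` s)%fset.
  have sx : simplex s (lam x) by exact: simplexS xs _ (simplex_carrier Ax).
  rewrite -(comps _ _ xs) in Wx; last exact: simplex_carrier.
  move/within_continuousP : cps => /(_ _ sx _ Wx); rewrite nbhs_simpl /=.
  move=> /(clam _ Dx); rewrite nbhs_simpl /=.
  apply: filterS => y Wy Dy ys; rewrite ys; apply: Wy.
  by rewrite -ys; apply: simplex_carrier; have [] := DP _ Dy.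
rewrite in_carrier => /andP[Ai xi] nsi.
have lami : (fun y => lam y i) @ within D (nbhs x) --> lam x i.
  apply: cvg_trans (@proj_continuous I (fun=> R) i (lam x)).
  exact: (cvg_app (fun v : {ptws I -> R} => v i) (clam _ Dx)).
have := lami _ (open_nbhs_nbhs (conj (@open_neq R 0) xi)).
rewrite nbhs_simpl /=; apply: filterS => y /= yi Dy ys.
by move: nsi; rewrite -ys in_carrier Ai yi.
Qed.

Lemma carrier_map_agrees p s t w : (t `<=` s)%fset -> simplex t w ->
  compatible p t -> p (carrier s w) w = p t w.
Proof.
move=> ts tw compt; symmetry; apply: compt; first exact: carrier_minimal.
by apply: simplex_carrier; exact: simplexS tw.
Qed.

(** The maps on the proper faces of [s] fit together to a map of its boundary,
    which is then filled in. *)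
Lemma skeleton_extension k (S B : set Y) p s :
  #|` s| = k.+2 -> sphere_extends R k S B ->
  (forall t, (t `<` s)%fset -> [/\ {within simplex t, continuous p t},
     p t @` simplex t `<=` S & compatible p t]) ->
  exists (g : {ptws I -> R} -> Y) (K : set Y),
    [/\ {within simplex s, continuous g}, compact K, K `<=` B,
      g @` simplex s `<=` K &
      forall t w, (t `<` s)%fset -> simplex t w -> g w = p t w].
Proof.
move=> sk SB pP.
have [||g [K [cg cK KB gK gE]]] :=
    simplex_extension (f := fun w => p (carrier s w) w) sk SB.
- apply/within_continuousP => w bw.
  apply: (@carrier_glue _ (boundary s) id) => [//||v bv].
    by apply: continuous_subspaceT => v; exact: cvg_id.
  have [cv _ compv] := pP _ (boundary_carrier bv).
  by split=> //; case: bv.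
- move=> _ [w bw <-]; have [_ + _] := pP _ (boundary_carrier bw); apply.
  by exists w => //; apply: simplex_carrier; case: bw.
exists g, K; split=> // t w ts tw; rewrite gE; last exact: proper_boundary tw.
by apply: carrier_map_agrees (fproper_sub ts) tw _; have [] := pP _ ts.
Qed.

(** The simplicial map induced by a map of the vertices. *)
Definition push (r : I -> I) s w : {ptws I -> R} :=
  fun j => \sum_(i <- s) if r i == j then w i else 0.

Lemma push_simplex (r : I -> I) s w :
  simplex s w -> simplex (r @` s)%fset (push r s w).
Proof.
move=> [w0 ws w1]; split.
- by move=> j; apply: sumr_ge0 => i _; case: ifP.
- move=> j nj; rewrite /push big_seq big1// => i si; case: eqP => // rij.
  by move: nj; rewrite -rij in_imfset.
- rewrite -w1 /push exchange_big /=; apply: eq_big_seq => i si.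
  rewrite (big_fsetD1 (r i)) ?in_imfset//= eqxx big_seq big1 ?addr0// => j.
  by rewrite !inE => /andP[jr _]; rewrite eq_sym (negPf jr).
Qed.

Lemma push_face (r : I -> I) s t w : (t `<=` s)%fset -> simplex t w ->
  push r s w = push r t w.
Proof.
move=> ts [_ wt _]; apply/funext => j; rewrite /push.
symmetry; apply: big_fset_incl => // i _.
by move=> /wt ->; case: ifP.
Qed.

Lemma push_continuous (r : I -> I) s A : {within A, continuous (push r s)}.
Proof.
apply/within_continuousP => w _; apply: cvg_ptws => j.
apply: (@cvg_sumr R _ _ I s
  (fun i (v : {ptws I -> R}) => if r i == j then v i else 0)) => i.
by case: (r i == j); [exact: ptws_coord_cvg|exact: cvg_cst].
Qed.

End Carrier.

(** * Selections on skeletons of nerves *)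

(** Extend constant maps. *)
Lemma sphere_extends_sub (R : realType) (Y : topologicalType) k (S B : set Y) :
  sphere_extends R k S B -> S `<=` B.
Proof.
move=> SB y Sy; have [||g [_ gB gy]] := SB (fun=> y).
- by apply: continuous_subspaceT; exact: cst_continuous.
- by move=> _ [v _ <-].
pose v : 'rV[R]_k.+1 := delta_mx ord0 ord0.
have v1 : sqnorm v = 1.
  rewrite /sqnorm (bigD1 ord0)//= big1 ?addr0 => [|i i0].
    by rewrite mxE !eqxx expr1n.
  by rewrite mxE (negPf i0) andbF expr0n.
by rewrite -(gy v v1); apply: gB; exists v => //; rewrite /unit_ball /= v1.
Qed.

Section Selection.
Context {R : realType} {X Y : topologicalType}.
Hypotheses (paraX : paracompact X) (hausX : hausdorff_space X) (x0 : X).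
Implicit Types (U : X -> set X) (p : {fset X} -> {ptws X -> R} -> Y).
Implicit Types (phi : X -> set Y).

(** [p] encodes a map of the [k]-skeleton of the nerve of [U] into [Y] that
    sends each simplex into the values of [phi] at the points of the
    intersection of the members of [U] that span it. *)
Definition nerve_selection U p phi k := forall s x,
  (#|` s| <= k.+1)%N -> isect U s x ->
  [/\ {within simplex s, continuous p s}, p s @` simplex s `<=` phi x &
      compatible p s].

Lemma simplex_vertex (s : {fset X}) (w : {ptws X -> R}) :
  simplex s w -> exists i, i \in s.
Proof.
case: (fset_0Vmem s) => [->|[i si]]; last by exists i.
by move=> [_ _ /eqP]; rewrite big_seq_fset0 eq_sym oner_eq0.
Qed.

Lemma nerve_selection0 phi :
  lower_locally_constant phi -> (forall x, phi x !=set0) ->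
  exists U p, [/\ open_family U, covers U, lf_family U &
    nerve_selection U p phi 0].
Proof.
move=> llc phi0; have /choice[y yP] := phi0.
have [||U [oU cU lfU UO]] :=
    precise_refinement paraX (O := fun i => [set x | [set y i] `<=` phi x]).
- by move=> i; apply: llc; exact: compact_set1.
- by move=> x; exists x => _ ->.
(* a simplex of dimension 0 has a single vertex, the head of [s] *)
exists U, (fun s _ => y (head x0 s)); split=> // s x s1 Ux; split.
- by apply: continuous_subspaceT; exact: cst_continuous.
- move=> _ [w sw <-]; have [i si] := simplex_vertex sw.
  apply: (UO (head x0 s) x) => //; apply: Ux.
  by rewrite -nth0 mem_nth// (cardfs_gt0 s); apply/fset0Pn; exists i.
- move=> t w ts tw; congr (y (head x0 _)).
  have [i ti] := simplex_vertex tw.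
  suff -> : t = s by [].
  apply/eqP; rewrite eqEfcard ts (leq_trans s1)// cardfs_gt0.
  by apply/fset0Pn; exists i.
Qed.

(** On a simplex of the nerve of [V] the new map is the composite of the
    simplicial map [r] with the old map [p] if [r] drops the dimension to at
    most [k], and otherwise with an extension [g] of [p] over the image of the
    simplex, chosen at a point [c s] that depends on the simplex. *)
Lemma nerve_selection_step U p phi psi k :
  open_family U -> covers U -> lf_family U ->
  nerve_selection U p phi k -> lower_locally_constant psi ->
  (forall x, sphere_extends R k (phi x) (psi x)) ->
  exists V q, [/\ open_family V, covers V, lf_family V &
    nerve_selection V q psi k.+1].
Proof.
move=> oU cU lfU pP llc ext.
have /choice[g gP] : forall xs : X * {fset X}, exists gK :
    ({ptws X -> R} -> Y) * set Y, isect U xs.2 xs.1 -> #|` xs.2| = k.+2 ->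
    [/\ {within simplex xs.2, continuous gK.1}, compact gK.2,
      gK.2 `<=` psi xs.1, gK.1 @` simplex xs.2 `<=` gK.2 &
      forall t w, (t `<` xs.2)%fset -> simplex t w -> gK.1 w = p t w].
  move=> [x s] /=; have [[Ux sk]|ns] := pselect (isect U s x /\ #|` s| = k.+2).
    have [t ts|g [K gK]] := @skeleton_extension R X Y k _ _ p s sk (ext x).
      apply: pP; first by rewrite -ltnS -sk fproper_ltn_card.
      by move=> i ti; apply: Ux; exact: (fsubsetP (fproper_sub ts)).
    by exists (g, K).
  by exists (p s, set0) => Ux sk; case: ns.
(* the points at which all extensions chosen at [x] are still admissible *)
pose O x := \bigcap_(s in [set` fpowerset (members U x)])
  [set x' | #|` s| = k.+2 -> (g (x, s)).2 `<=` psi x'].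
have memU x s : s \in fpowerset (members U x) -> isect U s x.
  by rewrite fpowersetE => /fsubsetP sU i /sU/(membersP _ _ lfU).
have [||V [r [oV cV lfV VU near_x]]] :=
    nerve_projection (O := O) paraX hausX oU cU lfU.
- move=> x; rewrite /O bigcap_fset big_seq.
  elim/big_ind : _ => [||s /memU Ux]; [exact: openT|exact: openI|].
  have [sk|sk] := pselect (#|` s| = k.+2); last first.
    rewrite (_ : mkset _ = setT); first exact: openT.
    by apply/seteqP; split=> // x' _ /sk.
  rewrite (_ : mkset _ = [set x' | (g (x, s)).2 `<=` psi x']).
    by apply: llc; have [] := gP (x, s) Ux sk.
  by apply/seteqP; split=> x' /=; [exact|].
- by move=> x s /memU Ux sk; have [] := gP (x, s) Ux sk.
have /choice[c cP] : forall s : {fset X}, exists x, isect V s !=set0 ->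
    forall i, i \in s -> V i `<=` O x /\ U (r i) x.
  move=> s; have [[y Vy]|nV] := pselect (isect V s !=set0).
    by have [x xP] := near_x y; exists x => _ i si; exact: xP (Vy _ si).
  by exists x0.
pose rs (s : {fset X}) := (r @` s)%fset.
have rsS (s t : {fset X}) : (t `<=` s)%fset -> (rs t `<=` rs s)%fset.
  move=> /fsubsetP ts; apply/fsubsetP => _ /imfsetP[i /= /ts si ->].
  exact: in_imfset.
have rsU s x : isect V s x -> isect U (rs s) x.
  by move=> Vx _ /imfsetP[i /= si ->]; apply/VU/Vx.
have rsc s : isect V s !=set0 -> isect U (rs s) (c s).
  by move=> /cP sc _ /imfsetP[i /= /sc[_ Ux] ->].
have rs_card s : (#|` rs s| <= #|` s|)%N by exact: leq_imfset_card.
pose q s : {ptws X -> R} -> Y :=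
  if (#|` rs s| <= k.+1)%N then p (rs s) \o push r s
  else (g (c s, rs s)).1 \o push r s.
have q_small s : (#|` rs s| <= k.+1)%N -> q s = p (rs s) \o push r s.
  by rewrite /q => ->.
have q_big s : (k.+1 < #|` rs s|)%N -> q s = (g (c s, rs s)).1 \o push r s.
  by rewrite /q ltnNge => /negPf ->.
exists V, q; split=> // s x sk Vx.
have pushs w : simplex s w -> simplex (rs s) (push r s w).
  exact: push_simplex.
have cpush (h : {ptws X -> R} -> Y) : {within simplex (rs s), continuous h} ->
    {within simplex s, continuous (h \o push r s)}.
  apply: (@within_comp_continuous _ _ _ _ (simplex (rs s)) (push r s)).
    exact: push_continuous.
  by move=> _ [w /pushs sw <-]; exact: sw.
have Vs0 : isect V s !=set0 by exists x.
have small t : (#|` rs t| <= k.+1)%N -> isect V t x ->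
    [/\ {within simplex (rs t), continuous p (rs t)},
     p (rs t) @` simplex (rs t) `<=` phi x & compatible p (rs t)].
  by move=> tk /rsU; exact: pP.
have full : (k.+1 < #|` rs s|)%N -> #|` rs s| = k.+2.
  by move=> rsk; apply/eqP; rewrite eqn_leq rsk andbT (leq_trans (rs_card s)).
have [rsk|/[dup] rsk /full rsk2] := leqP #|` rs s| k.+1; split.
- rewrite q_small//; apply: cpush.
  by have [] := small s rsk Vx.
- rewrite q_small// => _ [w /pushs sw <-]; apply: (sphere_extends_sub (ext x)).
  by have [_ + _] := small s rsk Vx; apply; exists (push r s w).
- move=> t w ts tw; rewrite !q_small//=; last first.
    by rewrite (leq_trans _ rsk)// fsubset_leq_card// rsS.
  have [_ _ compp] := small s rsk Vx.
  rewrite (push_face r ts tw); apply: compp; first exact: rsS.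
  exact: push_simplex.
- have [cg _ _ _ _] := gP (c s, rs s) (rsc _ Vs0) rsk2.
  by rewrite q_big//; exact: cpush.
- rewrite q_big// => _ [w sw <-].
  have [_ _ _ gK _] := gP (c s, rs s) (rsc _ Vs0) rsk2.
  have [i si] := simplex_vertex sw.
  have [VO _] := cP s Vs0 i si; apply: (VO _ (Vx _ si) (rs s)) => //.
    rewrite /= fpowersetE; apply/fsubsetP => j /(rsc _ Vs0) Uj.
    exact/membersP.
  by apply: gK; exists (push r s w) => //; exact: pushs.
- move=> t w ts tw; have [->//|tns] := eqVneq t s.
  have tlts : (t `<` s)%fset by rewrite fproperEneq tns.
  have tk : (#|` rs t| <= k.+1)%N.
    rewrite (leq_trans (rs_card t))// -ltnS (leq_trans _ sk)//.
    exact: fproper_ltn_card.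
  rewrite (q_small t)// (q_big s)//= (push_face r ts tw).
  have [_ _ _ _ gE] := gP (c s, rs s) (rsc _ Vs0) rsk2.
  apply: gE; last exact: push_simplex.
  rewrite fproperEneq rsS// andbT; apply: contraTneq tk => ->.
  by rewrite -ltnNge rsk2.
Qed.

(** The bound on the dimension provides a partition of unity with at most
    [k.+1] nonzero functions at each point, that is, a map of [X] into the
    skeleton of the nerve on which [p] is defined. *)
Lemma selection_of_nerve U p phi k : covering_dim_le X k ->
  open_family U -> covers U -> lf_family U -> nerve_selection U p phi k ->
  exists f : X -> Y, continuous f /\ forall x, phi x (f x).
Proof.
move=> dimX oU cU lfU pP.
have [V [oV cV VU Vk]] := dim_le_shrinking dimX oU cU lfU.
have lfV := lf_familyS VU lfU.
have [h [ch h0 hV h1]] := partition_of_unity (R := R) paraX hausX oV cV lfV.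
pose lam x : {ptws X -> R} := h^~ x.
have lamS x (A : {fset X}) : (forall i, V i x -> i \in A) -> simplex A (lam x).
  move=> VA; split=> [i|i nA|]; first exact: h0.
    by apply/eqP/negP => /negP/hV/VA; exact/negP.
  by apply: h1 => i /hV/VA.
have carV x (A : {fset X}) : isect V (carrier A (lam x)) x.
  by move=> i; rewrite in_carrier => /andP[_ /hV].
have pcar x (A : {fset X}) :
    [/\ {within simplex (carrier A (lam x)), continuous p (carrier A (lam x))},
      p (carrier A (lam x)) @` simplex (carrier A (lam x)) `<=` phi x &
      compatible p (carrier A (lam x))].
  apply: pP; first by apply: Vk; exists x; exact: carV.
  by move=> i /carV /VU.
exists (fun x => p (carrier (members V x) (lam x)) (lam x)).
split=> x; last first.
  have [_ + _] := pcar x (members V x); apply; exists (lam x) => //.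
  by apply: simplex_carrier; apply: lamS => i Vi; exact/membersP.
have [N xN /finite_fsetP[A AE]] := lfV x.
have NA y : N y -> forall i, V i y -> i \in A.
  by move=> Ny i Vi; have : [set` A] i by rewrite -AE; exists y.
have carE y : N y -> carrier (members V y) (lam y) = carrier A (lam y).
  move=> Ny; apply/fsetP => i; rewrite !in_carrier.
  have [/hV Vi|] := boolP (lam y i != 0); last by rewrite !andbF.
  by rewrite (NA _ Ny)// !andbT; apply/membersP.
rewrite /continuous_at carE; last exact: nbhs_singleton.
have NNx : nbhs x N° by exact: nbhs_interior.
have glue : (fun y => p (carrier A (lam y)) (lam y)) @ within N° (nbhs x) -->
    p (carrier A (lam x)) (lam x).
  apply: carrier_glue; first exact: nbhs_singleton NNx.
    apply/within_continuousP => y _; apply: cvg_ptws => i.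
    by apply: cvg_within_filter; exact: ch.
  move=> y /interior_subset Ny; have [cy _ compy] := pcar y A.
  by split=> //; apply: lamS; exact: NA.
rewrite within_interior// in glue; apply: cvg_trans glue.
by apply: near_eq_cvg; apply: filterS xN => y /carE ->.
Qed.

End Selection.

Theorem theorem3p1 (R : realType) (n : nat) (X Y : topologicalType)
    (phi : nat -> X -> set Y)
    (hausX : hausdorff_space X) (paraX : paracompact X)
    (dimX : covering_dim_le X n) (hausY : hausdorff_space Y)
    (phi_nonempty : forall k, (k <= n)%N -> forall x, phi k x !=set0)
    (phi_llc : forall k, (k <= n)%N -> lower_locally_constant (phi k))
    (phi_aspherical : forall k, (k < n)%N ->
       forall x, sphere_extends R k (phi k x) (phi k.+1 x)) :
  exists f : X -> Y, continuous f /\ forall x, phi n x (f x).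
Proof.
(* the empty map if [X] is empty; otherwise [x0] serves as a default vertex *)
have [[x0 _]|X0] := pselect (exists x : X, True); last first.
  have XF : X -> False by move=> x; apply: X0; exists x.
  by exists (fun x => False_rect Y (XF x)); split=> x; have := XF x.
have stage k : (k <= n)%N ->
    exists (U : X -> set X) (p : {fset X} -> {ptws X -> R} -> Y),
      [/\ open_family U, covers U, lf_family U &
          nerve_selection U p (phi k) k].
  elim: k => [|k IH] kn.
    by apply: nerve_selection0 => //; [exact: phi_llc|exact: phi_nonempty].
  have [U [p [oU cU lfU pP]]] := IH (ltnW kn).
  apply: (nerve_selection_step paraX hausX x0 oU cU lfU pP).
    exact: phi_llc.
  exact: phi_aspherical.
have [U [p [oU cU lfU pP]]] := stage n (leqnn n).
apply: (@selection_of_nerve R X Y paraX hausX U p (phi n) n) => //.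
Qed.
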